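(* Let $N=2n\geq4$ be even, $\omega=\exp(2\pi i/N)$, and let $u\in\mathbb{C}$ be admissible (i.e. $u\neq0$, $u^N\neq1$). Let $A=A_{N,u}$ be the algebra and $e_a$ ($a\in\mathbb{Z}/N\mathbb{Z}$) the idempotents defined in the context. Then the idempotents $e_a$ are primitive, and for each ordered pair $(a,b)$ with $\ell(a)\neq\ell(b)$ there is a nonzero element $x_{a,b}\in e_aAe_b$ such that $$e_aAe_b=\begin{cases}\mathbb{C}e_a,&a=b,\\ 0,&a\neq b\text{ and }\ell(a)=\ell(b),\\ \mathbb{C}x_{a,b},&\ell(a)\neq\ell(b).\end{cases}$$ The elements $x_{a,b}$ may be normalized so that, for $\ell(a)\neq\ell(b)$ and $\ell(b)\neq\ell(c)$, $x_{a,b}x_{b,c}=x_{a,c}$ when $\ell(a),\ell(b),\ell(c)$ are strictly increasing or strictly decreasing, whereas $x_{a,b}x_{b,c}=0$ when the level direction changes (i.e. otherwise). Products $x_{a,b}x_{b',c}$ with $b\neq b'$ are zero. Consequently, the isomorphism type of $A_{N,u}$ is independent of admissible $u$. The Gabriel quiver of $A_{N,u}$ has the residues $a\in\mathbb{Z}/N\mathbb{Z}$ as vertices and exactly one arrow in each direction between every pair of vertices in consecutive levels (levels differing by one), and no other arrows. With the arrows represented by the normalized elements $x_{a,b}$, every path that changes level direction is zero in $A_{N,u}$, and all monotone paths (paths along which the level is strictly increasing, or strictly decreasing) with the same endpoints agree.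
   Context: Index the standard basis of $\mathbb{C}^N$ by $j\in\mathbb{Z}/N\mathbb{Z}$ (writing $\epsilon_j$) and define $t\epsilon_j=\epsilon_{j-1}$, $d\epsilon_j=\omega^j\epsilon_j$. For admissible $u$ the operator $ud-u^{-1}d^{-1}$ is invertible; put $s=(ud-u^{-1}d^{-1})^{-1}$ and, on $\mathbb{C}^{2N}=\mathbb{C}^N\oplus\mathbb{C}^N$, $$T=\begin{pmatrix}t&0\\0&t^{-1}\end{pmatrix},\qquad \Lambda=\begin{pmatrix}s&s\\-s&-s\end{pmatrix}.$$ $A_{N,u}$ is the unital subalgebra of $\operatorname{End}(\mathbb{C}^{2N})$ generated by $T$ and $\Lambda$. For $a\in\mathbb{Z}/N\mathbb{Z}$, $e_a=\frac1N\sum_{k=0}^{N-1}\omega^{-ak}T^k$; these are pairwise orthogonal idempotents summing to the identity. The level of $a$ is $\ell(a)=\min\{\bar a,N-\bar a\}\in\{0,\ldots,n\}$, where $\bar a\in\{0,\ldots,N-1\}$ is the standard representative. The number of arrows of the Gabriel quiver between vertices $a$ and $b$ (in one of the two directions) is $\dim e_a(\operatorname{Jac}(A)/\operatorname{Jac}(A)^2)e_b$. *)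

(* Defs.v *)
From HB Require Import structures.
From mathcomp Require Import all_boot all_order all_algebra all_field.
From mathcomp Require Import boolp reals trigo.
From mathcomp Require Export complex.

Set Implicit Arguments.
Unset Strict Implicit.
Unset Printing Implicit Defensive.

Import GRing.Theory.

Local Open Scope ring_scope.

(* Throughout, a finite-dimensional unital algebra is given as a subalgebra A  *)
(* (with 1 \in A) of an ambient falgType aT.  Left ideals and the Jacobson     *)
(* radical are then subspaces of aT.                                           *)

Definition left_ideal (K : fieldType) (aT : falgType K)
    (A I : {vspace aT}) : bool :=
  ((I <= A) && (A * I <= I))%VS.

Definition maximal_left_ideal (K : fieldType) (aT : falgType K)
    (A M : {vspace aT}) : Prop :=
  [/\ left_ideal A M, M != A &
      forall I : {vspace aT}, left_ideal A I -> (M <= I)%VS -> I = M \/ I = A].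

(* Any subset closed under linear combinations is a {vspace _}; this is what   *)
(* turns the (a priori infinite) intersection defining Jac A into a subspace.  *)
Lemma vspace_of_pred (K : fieldType) (vT : vectType K) (P : vT -> Prop) :
  P 0 -> (forall (k : K) u v, P u -> P v -> P (k *: u + v)) ->
  exists U : {vspace vT}, forall v, v \in U <-> P v.
Proof.
move=> P0 Plin.
pose sub (U : {vspace vT}) := forall v, v \in U -> P v.
pose Q d := `[< exists2 U, sub U & \dim U = d >].
have exQ : exists d, Q d.
  exists 0%N; apply/asboolP; exists 0%VS; last by rewrite dimv0.
  by move=> v /[!memv0]/eqP->.
have ubQ d : Q d -> (d <= \dim {:vT})%N.
  by move=> /asboolP[U _ <-]; apply/dimvS/subvf.
case: (ex_maxnP exQ ubQ) => d /asboolP[U subU dimU] maxd.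
exists U => v; split; first exact: subU.
move=> Pv.
have sUv : sub (<[v]> + U)%VS.
  by move=> w /memv_addP[_ /vlineP[k ->]] [u Uu ->]; apply: Plin => //; apply: subU.
have le_d : (\dim (<[v]> + U) <= d)%N.
  by apply: maxd; apply/asboolP; exists (<[v]> + U)%VS.
have /eqP -> : U == (<[v]> + U)%VS.
  by rewrite eqEdim addvSr dimU.
exact: (subvP (addvSl _ _)) (memv_line v).
Qed.

Lemma jacobson_exists (K : fieldType) (aT : falgType K) (A : {vspace aT}) :
  exists J : {vspace aT}, forall x : aT, x \in J <->
    (x \in A /\ forall M, maximal_left_ideal A M -> x \in M).
Proof.
apply: vspace_of_pred => [|k x y [Ax Mx] [Ay My]].
  by split=> [|M _]; apply: mem0v.
split=> [|M maxM]; first by rewrite memvD ?memvZ.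
by rewrite memvD ?memvZ ?Mx ?My.
Qed.

Definition jacobson (K : fieldType) (aT : falgType K) (A : {vspace aT}) :
    {vspace aT} :=
  projT1 (cid (jacobson_exists A)).

Lemma jacobsonP (K : fieldType) (aT : falgType K) (A : {vspace aT}) (x : aT) :
  x \in jacobson A <->
    (x \in A /\ forall M, maximal_left_ideal A M -> x \in M).
Proof. exact: (projT2 (cid (jacobson_exists A)) x). Qed.

Definition primitive_idempotent (K : fieldType) (aT : falgType K)
    (A : {vspace aT}) (e : aT) : Prop :=
  [/\ e \in A, e * e = e, e != 0 &
      forall f g : aT, f \in A -> g \in A -> f * f = f -> g * g = g ->
        f * g = 0 -> g * f = 0 -> e = f + g -> f = 0 \/ g = 0].

(* e U f = {e x f | x in U} *)
Definition peirce (K : fieldType) (aT : falgType K)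
    (e : aT) (U : {vspace aT}) (f : aT) : {vspace aT} :=
  (<[e]> * U * <[f]>)%VS.

(* e A and f A are isomorphic right A-modules; a linear map e A -> f A is      *)
(* represented by one of its extensions h to aT.                               *)
Definition isomorphic_projectives (K : fieldType) (aT : falgType K)
    (A : {vspace aT}) (e f : aT) : Prop :=
  exists h : 'End(aT),
    [/\ (h @: (<[e]> * A) = <[f]> * A)%VS,
        (lker h :&: (<[e]> * A) = 0)%VS &
        forall x y : aT, x \in (<[e]> * A)%VS -> y \in A -> h (x * y) = h x * y].

(* dim of e (Jac A / Jac^2 A) f, i.e. of the image of e Jac(A) f in            *)
(* Jac A / Jac^2 A.                                                            *)
Definition num_arrows (K : fieldType) (aT : falgType K)
    (A : {vspace aT}) (e f : aT) : nat :=
  (\dim (peirce e (jacobson A) f + jacobson A * jacobson A)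
   - \dim (jacobson A * jacobson A))%N.

(* The class of x is a basis of e (Jac A / Jac^2 A) f. *)
Definition represents_arrow (K : fieldType) (aT : falgType K)
    (A : {vspace aT}) (e f x : aT) : Prop :=
  [/\ x \in peirce e (jacobson A) f,
      x \notin (jacobson A * jacobson A)%VS &
      (peirce e (jacobson A) f + jacobson A * jacobson A
       = <[x]> + jacobson A * jacobson A)%VS].

(* The family e exhibits Q as the Gabriel quiver of A, with vertex set I: the  *)
(* e i are a complete family of orthogonal primitive idempotents, one for each *)
(* indecomposable projective module, and Q counts arrows.                      *)
Definition is_gabriel_quiver (K : fieldType) (aT : falgType K)
    (A : {vspace aT}) (I : finType) (e : I -> aT) (Q : I -> I -> nat) : Prop :=
  [/\ forall i, primitive_idempotent A (e i),
      forall i j, i != j -> e i * e j = 0,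
      \sum_i e i = 1,
      forall i j, i != j -> ~ isomorphic_projectives A (e i) (e j) &
      forall i j, num_arrows A (e i) (e j) = Q i j].

Definition algebra_isomorphic (K : fieldType) (aT bT : falgType K)
    (A : {aspace aT}) (B : {aspace bT}) : Prop :=
  exists f : 'AHom(subvs_of A, subvs_of B), bijective f.

(* The value of the path a -> p_0 -> p_1 -> ... in which each step a -> b is   *)
(* read as x a b; the trivial path at a is e a.                                *)
Fixpoint path_value (S : pzRingType) (I : Type) (e : I -> S) (x : I -> I -> S)
    (a : I) (p : seq I) : S :=
  if p is b :: p' then x a b * path_value e x b p' else e a.

(* From here on N > 1 is assumed, so that 'Z_N has N elements. *)

Definition omega (R : realType) (N : nat) : R[i] :=
  Complex (cos (2 * pi / N%:R)) (sin (2 * pi / N%:R)).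

Definition admissible (R : realType) (N : nat) (u : R[i]) : Prop :=
  u != 0 /\ u ^+ N != 1.

Notation opN R N := 'M[R[i]]_((Zp_trunc N).+2).
(* The size is convertible to N + N; this form exposes the successor that the  *)
(* algebra structure on square matrices is keyed on.                           *)
Notation op2N R N := 'M[R[i]]_(((Zp_trunc N).+1 + (Zp_trunc N).+2).+1).

(* Matrices act on column vectors: column j is the image of epsilon_j. *)
Definition tmx (R : realType) (N : nat) : opN R N :=
  \matrix_(i < (Zp_trunc N).+2, j < (Zp_trunc N).+2)
    ((i : 'Z_N) == (j : 'Z_N) - 1)%:R.

Definition dmx (R : realType) (N : nat) : opN R N :=
  \matrix_(i < (Zp_trunc N).+2, j < (Zp_trunc N).+2)
    (if i == j then omega R N ^+ (j : nat) else 0).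

Definition smx (R : realType) (N : nat) (u : R[i]) : opN R N :=
  (u *: dmx R N - u^-1 *: (dmx R N)^-1)^-1.

Definition Tmx (R : realType) (N : nat) : op2N R N :=
  block_mx (tmx R N) 0 0 (tmx R N)^-1.

Definition Lambdamx (R : realType) (N : nat) (u : R[i]) : op2N R N :=
  block_mx (smx N u) (smx N u) (- smx N u) (- smx N u).

Definition algA (R : realType) (N : nat) (u : R[i]) : {aspace op2N R N} :=
  agenv_aspace <<[:: Tmx R N; Lambdamx N u]>>%VS.

Definition idem (R : realType) (N : nat) (a : 'Z_N) : op2N R N :=
  N%:R^-1 *: \sum_(k < N) (omega R N ^- (a * k)%N) *: Tmx R N ^+ k.

Definition level (N : nat) (a : 'Z_N) : nat := minn a (N - a).

Definition consecutive_levels (N : nat) (a b : 'Z_N) : bool :=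
  (level b == (level a).+1) || (level a == (level b).+1).

Definition monotone_vertices (N : nat) (s : seq 'Z_N) : bool :=
  sorted ltn (map (@level N) s) || sorted gtn (map (@level N) s).

(* Main.v *)
(** In an eigenbasis of T, with (v_a, 0) and (0, v_{-a}) spanning the image of
    e_a, the block e_a Lambda e_b is 0 when a and b have the same parity and
    otherwise has rank one.  Its image depends only on a and on whether the
    level increases or decreases from a to b, and its kernel only on b and on
    that direction.  Hence each e_a C^{2N} has a basis of two lines, one per
    direction, in which the nonzero blocks are scalar multiples of the matrix
    units E s a b, s being the direction.  So A is spanned by the e_a and by the
    x_{a,b} = E s a b with s the direction from the level of a to that of b:
    every claim follows from the multiplication table of matrix units.  Since u
    only enters through the basis, the algebras for u and v are conjugate. *)

Require Import Defs.
From HB Require Import structures.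
From mathcomp Require Import all_boot all_order all_algebra all_field.
From mathcomp Require Import boolp reals trigo.
From mathcomp Require Import zify ring lra.

Set Implicit Arguments.
Unset Strict Implicit.
Unset Printing Implicit Defensive.

Import Order.TTheory GRing.Theory Num.Theory.

Local Open Scope ring_scope.

(** * Peirce components of a subspace *)

Section Peirce.

Variables (K : fieldType) (aT : falgType K).
Implicit Types (e f x : aT) (U W : {vspace aT}).

Lemma memv_peirce e U f x : x \in U -> e * x * f \in peirce e U f.
Proof. by move=> Ux; rewrite !memv_mul ?memv_line. Qed.

Lemma peirce_subv e U f W :
  (forall x, x \in U -> e * x * f \in W) -> (peirce e U f <= W)%VS.
Proof.
move=> eUfW; apply/prodvP => y _ yeU /vlineP[k ->].
rewrite -scalerAr memvZ //.
suff: (<[e]> * U <= amulr f @^-1: W)%VS.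
  by move/subvP/(_ _ yeU); rewrite -memv_preim lfunE.
apply/prodvP => _ x /vlineP[c ->] Ux.
by rewrite -scalerAl memvZ // -memv_preim lfunE /= eUfW.
Qed.

End Peirce.

(** * Algebras spanned by level-monotone matrix units *)

Section LevelAlgebra.

Variables (K : fieldType) (aT : falgType K) (I : finType) (l : I -> nat).
Variable E : bool -> I -> I -> aT.

(** Two mutually orthogonal full systems of matrix units, one per direction: the [E s a b] span a
    product of two full matrix algebras containing the ambient unit. *)
Definition matrix_units : Prop :=
  [/\ forall s r a b c d,
        E s a b * E r c d = if (s == r) && (b == c) then E s a d else 0,
      forall s a b, E s a b != 0
    & \sum_a (E true a a + E false a a) = 1].

Definition vertex a := E true a a + E false a a.

(* The boolean index of E is the direction: true for an increasing level. *)
Definition arrow a b := E (l a < l b)%N a b.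

(** The value 0 for distinct vertices on one level lets every Peirce component, zero or not, be
    written as the line of [level_unit a b]. *)
Definition level_unit a b :=
  if a == b then vertex a else if l a == l b then 0 else arrow a b.

Definition level_span := (\sum_(p : I * I) <[level_unit p.1 p.2]>)%VS.

Local Notation e := vertex.
Local Notation x := arrow.
Local Notation z := level_unit.
Local Notation S := level_span.

Hypothesis muE : matrix_units.

Let E_mul s r a b c d :
  E s a b * E r c d = if (s == r) && (b == c) then E s a d else 0.
Proof. by case: muE. Qed.

Let E_neq0 s a b : E s a b != 0.
Proof. by case: muE. Qed.

Lemma sum_vertex : \sum_a e a = 1.
Proof. by case: muE. Qed.

Lemma vertex_mul a b : e a * e b = if a == b then e a else 0.
Proof.
rewrite /e mulrDl !mulrDr !E_mul /=; case: eqP => [->|_]; last by rewrite !addr0.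
by rewrite addr0 add0r.
Qed.

Lemma vertex_idem a : e a * e a = e a.
Proof. by rewrite vertex_mul eqxx. Qed.

Lemma vertex_neq0 a : e a != 0.
Proof.
apply: contraNneq (E_neq0 true a a) => e0.
have : e a * E true a a = 0 by rewrite e0 mul0r.
by rewrite /e mulrDl !E_mul /= eqxx addr0 => ->.
Qed.

Lemma vertex_E s a b c : e a * E s b c = if a == b then E s a c else 0.
Proof.
by rewrite /e mulrDl !E_mul; case: s; case: (a =P b); rewrite /= ?addr0 ?add0r.
Qed.

Lemma E_vertex s a b c : E s a b * e c = if b == c then E s a b else 0.
Proof.
by rewrite /e mulrDr !E_mul; case: s; case: (b =P c) => [->|];
  rewrite /= ?addr0 ?add0r.
Qed.

Lemma vertex_unitl a b : e a * z a b = z a b.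
Proof.
rewrite /z; case: (a =P b) => [_|_]; first exact: vertex_idem.
by case: eqP; rewrite ?mulr0 // vertex_E eqxx.
Qed.

Lemma vertex_unitr a b : z a b * e b = z a b.
Proof.
rewrite /z; case: (a =P b) => [->|_]; first exact: vertex_idem.
by case: eqP; rewrite ?mul0r // E_vertex eqxx.
Qed.

Lemma unit_arrow a b : l a != l b -> z a b = x a b.
Proof. by rewrite /z; case: (a =P b) => [->|_]; [rewrite eqxx|move/negPf->]. Qed.

Lemma unit_comp a b c d :
  e a * z c d * e b = if (a == c) && (b == d) then z a b else 0.
Proof.
rewrite -(vertex_unitl c d) -(vertex_unitr c d) !mulrA vertex_mul -mulrA.
rewrite vertex_mul [d == b]eq_sym; case: eqP => [->|_] /=; last by rewrite !mul0r.
case: eqP => [->|_]; last by rewrite mulr0.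
by rewrite vertex_unitl vertex_unitr.
Qed.

(** Matrix units of different directions annihilate each other, so both steps must move the level
    the same way; by transitivity the product then has that direction too. *)
Lemma arrow_mul a b c : l a != l b -> l b != l c ->
  x a b * x b c =
    if (l a < l b < l c)%N || (l c < l b < l a)%N then x a c else 0.
Proof.
rewrite /x E_mul eqxx andbT.
case: (ltngtP (l a) (l b)) => // ab _; case: (ltngtP (l b) (l c)) => //= bc _.
  by rewrite (ltn_trans ab bc).
by rewrite ltnNge ltnW // (ltn_trans bc ab).
Qed.

Lemma arrow_mul0 a b b' c : b != b' -> x a b * x b' c = 0.
Proof. by rewrite /x E_mul => /negPf->; rewrite andbF. Qed.

Lemma arrow_back a b : l a != l b -> x a b * x b a = 0.
Proof.
move=> ab; rewrite arrow_mul // 1?eq_sym //.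
by case: (ltngtP (l a) (l b)) ab.
Qed.

Lemma arrow_neq0 a b : x a b != 0.
Proof. exact: E_neq0. Qed.

Lemma unit_mul a b c : z a b * z b c \in <[z a c]>%VS.
Proof.
have [->|ab] := eqVneq a b.
  by rewrite {1}/z eqxx vertex_unitl memv_line.
have [<-|bc] := eqVneq b c.
  by rewrite {2}/z eqxx vertex_unitr memv_line.
rewrite {1 2}/z (negPf ab) (negPf bc).
case: eqP => [_|/eqP lab]; first by rewrite mul0r mem0v.
case: eqP => [_|/eqP lbc]; first by rewrite mulr0 mem0v.
rewrite arrow_mul //; case: ifP => [mon|_]; last exact: mem0v.
rewrite unit_arrow ?memv_line // neq_ltn.
by case/orP: mon => /andP[h1 h2]; rewrite (ltn_trans h1 h2) ?orbT.
Qed.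

Lemma comp_decomp y : y = \sum_(p : I * I) e p.1 * y * e p.2.
Proof.
rewrite -[LHS]mul1r -[LHS]mulr1 -sum_vertex !mulr_suml.
under eq_bigr do rewrite mulr_sumr.
by rewrite pair_bigA.
Qed.

Lemma comp_mul u v a b :
  e a * (u * v) * e b = \sum_c (e a * u * e c) * (e c * v * e b).
Proof.
rewrite -[u in LHS]mulr1 -sum_vertex.
rewrite mulr_sumr mulr_suml mulr_sumr mulr_suml; apply: eq_bigr => c _.
by rewrite -[e c in LHS]vertex_idem !mulrA.
Qed.

Lemma span_comp y a b : y \in S -> e a * y * e b \in <[z a b]>%VS.
Proof.
suff: (level_span <= (amulr (e b) \o amull (e a))%VF @^-1: <[z a b]>)%VS.
  by move/subvP=> sub Sy; have := sub y Sy; rewrite -memv_preim !lfunE /= !lfunE.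
apply/subv_sumP => [] [c d] _; rewrite -memvE -memv_preim !lfunE /= !lfunE /=.
by rewrite unit_comp; case: ifP => _; rewrite ?memv_line ?mem0v.
Qed.

(** Since the vertices sum to 1, an element is the sum of its Peirce components, and membership can
    be tested on each of them. *)
Lemma mem_level_spanP y :
  reflect (forall a b, e a * y * e b \in <[z a b]>%VS) (y \in S).
Proof.
apply: (iffP idP) => [Sy a b|Sy]; first exact: span_comp.
by rewrite (comp_decomp y) memv_sumr.
Qed.

Lemma unit_span a b : z a b \in S.
Proof.
apply/mem_level_spanP => c d; rewrite unit_comp.
by case: ifP => _; rewrite ?memv_line ?mem0v.
Qed.

Lemma vertex_span a : e a \in S.
Proof. by have := unit_span a a; rewrite /z eqxx. Qed.

Lemma arrow_span a b : l a != l b -> x a b \in S.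
Proof. by move/unit_arrow <-; exact: unit_span. Qed.

Lemma span1 : 1 \in S.
Proof. by rewrite -sum_vertex rpred_sum // => a _; apply: vertex_span. Qed.

Lemma span_mul u v : u \in S -> v \in S -> u * v \in S.
Proof.
move=> Su Sv; apply/mem_level_spanP => a b; rewrite comp_mul rpred_sum // => c _.
have /vlineP[k ->] := span_comp a c Su.
have /vlineP[k' ->] := span_comp c b Sv.
by rewrite -scalerAl -scalerAr !memvZ // unit_mul.
Qed.

Lemma peirce_span a b : peirce (e a) S (e b) = <[z a b]>%VS.
Proof.
apply/eqP; rewrite eqEsubv peirce_subv => [|y]; last exact: span_comp.
rewrite -memvE -{1}(vertex_unitl a b) -{1}(vertex_unitr a b) mulrA memv_peirce //.
exact: unit_span.
Qed.

(** * Primitivity and pairwise non-isomorphism of the vertices *)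

Lemma span_diag y a : y \in S -> exists k, e a * y * e a = k *: e a.
Proof.
by move=> Sy; have := span_comp a a Sy; rewrite /z eqxx => /vlineP.
Qed.

Lemma vertex_primitive a : primitive_idempotent S (e a).
Proof.
split; [exact: vertex_span|exact: vertex_idem|exact: vertex_neq0|].
move=> f g Sf Sg ff gg fg gf eE.
(* Orthogonality gives [f = e a * f * e a], an element of the one-dimensional corner at [a];
   idempotence then forces [k] to be 0 or 1. *)
have [k fE] : exists k, f = k *: e a.
  have [k kE] := span_diag a Sf.
  by exists k; rewrite -kE eE mulrDl gf addr0 ff mulrDr fg addr0 ff.
have /eqP : (k * k - k) *: e a = 0.
  move: ff; rewrite fE -scalerAl -scalerAr vertex_idem scalerA scalerBl => ->.
  by rewrite subrr.
rewrite scaler_eq0 (negPf (vertex_neq0 a)) orbF -[X in _ - X]mulr1 -mulrBr.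
rewrite mulf_eq0 => /orP[/eqP k0|]; first by left; rewrite fE k0 scale0r.
rewrite subr_eq0 => /eqP k1; right.
by apply: (addrI f); rewrite -eE addr0 fE k1 scale1r.
Qed.

Lemma span_offdiag_mul y y' a b : a != b -> y \in S -> y' \in S ->
  (e a * y * e b) * (e b * y' * e a) = 0.
Proof.
move=> ab Sy Sy'; have /vlineP[k ->] := span_comp a b Sy.
have /vlineP[k' ->] := span_comp b a Sy'.
rewrite -scalerAl -scalerAr /z (negPf ab) [b == a]eq_sym (negPf ab).
rewrite [l b == l a]eq_sym; case: eqP => [_|/eqP lab].
  by rewrite mul0r !scaler0.
by rewrite arrow_back // !scaler0.
Qed.

(** A detour through another vertex contributes nothing, its two components being zero or of
    opposite directions. Compression to the corner at [a] is therefore a character. *)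
Lemma span_diag_mul y y' a : y \in S -> y' \in S ->
  e a * (y * y') * e a = (e a * y * e a) * (e a * y' * e a).
Proof.
move=> Sy Sy'; rewrite comp_mul (bigD1 a) //= big1 ?addr0 // => c ca.
by rewrite span_offdiag_mul // eq_sym.
Qed.

(** An isomorphism would factor [e b] into a component from [b] to [a] times one from [a] to [b],
    and such products vanish for [a != b]. *)
Lemma vertex_not_isomorphic a b :
  a != b -> ~ isomorphic_projectives S (e a) (e b).
Proof.
move=> ab [h [himg _ hmod]].
have eaP y : y \in S -> e a * y \in (<[e a]> * S)%VS.
  by move=> Sy; rewrite memv_mul ?memv_line.
have : h (e a) \in (<[e b]> * S)%VS.
  by rewrite -himg -{1}(vertex_idem a) memv_img // eaP ?vertex_span.
have eb_id y : y \in (<[e b]> * S)%VS -> e b * y = y /\ y \in S.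
  move=> yP; split.
    suff: (<[e b]> * S <= lker (amull (e b) - \1%VF))%VS.
      by move/subvP/(_ y yP)/eqlfunP; rewrite !lfunE.
    apply/prodvP => _ w /vlineP[k ->] _; apply/eqlfunP; rewrite !lfunE /=.
    by rewrite -scalerAl -scalerAr mulrA vertex_idem.
  suff: (<[e b]> * S <= S)%VS by move/subvP; apply.
  apply/prodvP => _ w /vlineP[k ->] Sw; rewrite -scalerAl memvZ // span_mul //.
  exact: vertex_span.
case/eb_id => hbl hS.
have : e b \in (h @: (<[e a]> * S))%VS.
  by rewrite himg -{1}(vertex_idem b) memv_mul ?memv_line ?vertex_span.
case/memv_imgP => y.
have -> : (<[e a]> * S)%VS = (amull (e a) @: S)%VS.
  apply/eqP; rewrite eqEsubv; apply/andP; split; apply/subvP => w; last first.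
    by case/memv_imgP => t St ->; rewrite lfunE /= eaP.
  apply/subvP/prodvP => _ t /vlineP[k ->] St; rewrite -scalerAl memvZ //.
  by have := memv_img (amull (e a)) St; rewrite lfunE.
case/memv_imgP => t St -> ; rewrite lfunE /= => ebE.
have /eqP := vertex_neq0 b; apply.
have -> : e b = (e b * h (e a) * e a) * (e a * t * e b).
  rewrite hbl -hmod ?vertex_span ?vertex_idem //; last first.
    by rewrite -{1}(vertex_idem a) eaP ?vertex_span.
  rewrite -hmod; first last.
  - by rewrite !span_mul ?vertex_span.
  - by rewrite -{1}(vertex_idem a) eaP ?vertex_span.
  by rewrite !mulrA vertex_idem hmod ?vertex_span ?eaP // -ebE vertex_idem.
by rewrite span_offdiag_mul // eq_sym.
Qed.

(* The kernel of the character y |-> e a * y * e a of the algebra. *)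
Definition diag0 a := (S :&: lker (amulr (e a) \o amull (e a))%VF)%VS.

Lemma mem_diag0 a y : (y \in diag0 a) = (y \in S) && (e a * y * e a == 0).
Proof. by rewrite memv_cap memv_ker !lfunE /= !lfunE. Qed.

(** * Maximal left ideals and the Jacobson radical *)

Lemma span_left_ideal M : left_ideal S M ->
  (M <= S)%VS /\ (forall y m, y \in S -> m \in M -> y * m \in M).
Proof. by case/andP => MS /prodvP SM; split=> // y m Sy Mm; apply: SM. Qed.

Lemma diag0_maximal a : maximal_left_ideal S (diag0 a).
Proof.
have idl : left_ideal S (diag0 a).
  rewrite /left_ideal capvSl; apply/prodvP => y m Sy.
  rewrite !mem_diag0 => /andP[Sm /eqP m0].
  by rewrite span_mul // span_diag_mul // m0 mulr0 eqxx.
split=> //.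
  apply/eqP => eqS; have := vertex_span a; rewrite -eqS mem_diag0.
  by rewrite !vertex_idem (negPf (vertex_neq0 a)) andbF.
move=> L idL sub; have [LS Lmul] := span_left_ideal idL.
have [Ld|] := boolP (L <= diag0 a)%VS.
  by left; apply/eqP; rewrite eqEsubv Ld.
case/subvPn => y Ly; have Sy := subvP LS _ Ly.
rewrite mem_diag0 Sy /= => y0; right; apply/eqP; rewrite eqEsubv LS /=.
have [k kE] := span_diag a Sy.
have k0 : k != 0 by apply: contraNneq y0 => k0; rewrite kE k0 scale0r.
apply/subvP => w Sw; have [c cE] := span_diag a Sw.
(* The factor [c / k] cancels the corner of [w] at [a], so [w] is a multiple of [y] modulo
   [diag0 a]. *)
rewrite -(subrK ((c / k) *: y) w) memvD ?memvZ // (subvP sub) //.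
rewrite mem_diag0 memvB ?memvZ //= mulrBr mulrBl -scalerAr -scalerAl kE cE.
by rewrite scalerA divfK // subrr.
Qed.

(* If a maximal left ideal M missed x a b then 1 = m + y * x a b with m \in M;
   since x a b * y * x a b = 0, multiplying by 1 + y * x a b gives 1 \in M. *)
Lemma arrow_in_maximal M a b :
  maximal_left_ideal S M -> l a != l b -> x a b \in M.
Proof.
move=> [idM M_neq max] lab; have [MS Mmul] := span_left_ideal idM.
apply: contraT => xM; case/eqP: M_neq.
have Sx := arrow_span lab.
have idL : left_ideal S (M + S * <[x a b]>)%VS.
  apply/andP; split.
    rewrite subv_add MS; apply/prodvP => y _ Sy /vlineP[k ->].
    by rewrite -scalerAr memvZ // span_mul.
  apply/prodvP => y _ Sy /memv_addP[m Mm [_ /memv_cosetP[w Sw ->] ->]].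
  rewrite mulrDr mulrA memv_add ?Mmul //.
  by rewrite memv_mul ?memv_line ?span_mul.
have [L_M|L_S] := max _ idL (addvSl _ _).
  case/negP: xM; rewrite -L_M (subvP (addvSr _ _)) //.
  by apply/memv_cosetP; exists 1; rewrite ?span1 ?mul1r.
have := span1; rewrite -{1}L_S => /memv_addP[m Mm [_ /memv_cosetP[y Sy ->] E1]].
have xyx : x a b * y * x a b = 0.
  have -> : x a b * y * x a b = (x a b * (e b * y * e a)) * x a b.
    rewrite /x !mulrA E_vertex eqxx.
    by rewrite -(mulrA _ (e a)) vertex_E eqxx.
  have /vlineP[k ->] := span_comp b a Sy.
  rewrite unit_arrow 1?eq_sym // -scalerAr arrow_back //.
  by rewrite scaler0 mul0r.
have M1 : 1 \in M.
  have -> : 1 = (1 + y * x a b) * m.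
    have -> : m = 1 - y * x a b by rewrite E1 addrK.
    rewrite mulrBr mulr1 mulrDl mul1r -mulrA (mulrA (x a b)) xyx mulr0 addr0.
    by rewrite addrK.
  by rewrite Mmul // memvD ?span1 // span_mul.
apply/eqP; rewrite eqEsubv MS; apply/subvP => w Sw.
by rewrite -[w]mulr1 Mmul.
Qed.

(** The maximal left ideals [diag0 a] force all diagonal components to vanish; conversely,
    off-diagonal components are zero or multiples of arrows, which lie in every maximal left
    ideal. *)
Lemma mem_jacobson_span y :
  y \in jacobson S <-> y \in S /\ forall a, e a * y * e a = 0.
Proof.
rewrite jacobsonP; split=> -[Sy Hy]; split=> //.
  by move=> a; have := Hy _ (diag0_maximal a); rewrite mem_diag0 => /andP[_ /eqP].
move=> M maxM; rewrite (comp_decomp y) rpred_sum // => -[a b] _ /=.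
have /vlineP[k kE] := span_comp a b Sy.
have [->|ab] := eqVneq a b; first by rewrite Hy mem0v.
rewrite kE /z (negPf ab) memvZ //; case: eqP => [_|/eqP lab]; first exact: mem0v.
exact: arrow_in_maximal.
Qed.

Lemma arrow_jacobson a b : l a != l b -> x a b \in jacobson S.
Proof.
move=> lab; apply/mem_jacobson_span; split; first exact: arrow_span.
move=> c; rewrite -(unit_arrow lab) unit_comp.
by case: ifP => // /andP[/eqP ca /eqP cb]; rewrite -ca -cb eqxx in lab.
Qed.

Lemma jacobson_comp y a b : y \in jacobson S ->
  exists k, e a * y * e b = (if l a == l b then 0 else k) *: x a b.
Proof.
case/mem_jacobson_span => Sy y0.
have [->|ab] := eqVneq a b; first by exists 0; rewrite eqxx y0 scale0r.
have /vlineP[k ->] := span_comp a b Sy; exists k.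
by rewrite /z (negPf ab); case: ifP; rewrite ?scale0r ?scaler0.
Qed.

Lemma peirce_jacobson a b :
  peirce (e a) (jacobson S) (e b) = if l a == l b then 0%VS else <[x a b]>%VS.
Proof.
apply/eqP; rewrite eqEsubv; apply/andP; split.
  apply: peirce_subv => y Jy; have [k ->] := jacobson_comp a b Jy.
  by case: ifP => _; rewrite ?scale0r ?memvZ ?mem0v ?memv_line.
case: eqP => [_|/eqP lab]; first exact: sub0v.
rewrite -memvE -(unit_arrow lab) -vertex_unitl -vertex_unitr mulrA.
by rewrite memv_peirce // unit_arrow // arrow_jacobson.
Qed.

(** * The square of the radical, generation by one element, and the Gabriel quiver *)

Definition consecutive a b := (l b == (l a).+1) || (l a == (l b).+1).

Lemma consecutive_neq a b : consecutive a b -> l a != l b.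
Proof. by case/orP => /eqP->; rewrite neq_ltn ltnSn ?orbT. Qed.

(** A nonzero product of two arrows passes through a level strictly between those of its ends, and
    consecutive levels leave no room for one. *)
Lemma jacobson_sqr_comp y a b : consecutive a b ->
  y \in (jacobson S * jacobson S)%VS -> e a * y * e b = 0.
Proof.
move=> cab Jy; apply/eqP.
suff: (jacobson S * jacobson S <= lker (amulr (e b) \o amull (e a))%VF)%VS.
  by move/subvP/(_ y Jy); rewrite memv_ker !lfunE /= !lfunE.
apply/prodvP => v w Jv Jw; rewrite memv_ker !lfunE /= !lfunE /=.
rewrite comp_mul big1 // => c _.
have [k ->] := jacobson_comp a c Jv; have [k' ->] := jacobson_comp c b Jw.
case: eqP => [_|/eqP lac]; first by rewrite scale0r mul0r.
case: eqP => [_|/eqP lcb]; first by rewrite scale0r mulr0.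
rewrite -scalerAl -scalerAr arrow_mul //.
case: ifP => [mon|_]; last by rewrite !scaler0.
by exfalso; move: cab mon; rewrite /consecutive; lia.
Qed.

Lemma arrow_jacobson_sqr a b : consecutive a b ->
  x a b \notin (jacobson S * jacobson S)%VS.
Proof.
move=> cab; apply/negP => /(jacobson_sqr_comp cab) x0.
have lab := consecutive_neq cab; have /eqP := arrow_neq0 a b; apply.
by rewrite -(unit_arrow lab) -vertex_unitl -vertex_unitr mulrA unit_arrow.
Qed.

Lemma consecutive_represents_arrow a b : consecutive a b ->
  represents_arrow S (e a) (e b) (x a b).
Proof.
move=> cab; have lab := consecutive_neq cab.
split; last by rewrite peirce_jacobson (negPf lab).
  by rewrite peirce_jacobson (negPf lab) memv_line.
exact: arrow_jacobson_sqr.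
Qed.

(** The levels in use have no gaps, so an arrow spanning two or more levels factors through a vertex
    in between. *)
Hypothesis level_surj : forall b k, (k <= l b)%N -> exists c, l c = k.

Lemma level_between a b :
  ((l a).+1 < l b)%N -> exists c, (l a < l c < l b)%N.
Proof.
by move=> ab; have [c lc] := level_surj (ltnW ab); exists c; rewrite lc ltnSn.
Qed.

(** Cutting [y] by the vertices yields the arrows between levels of opposite parity; any other arrow
    is a product of two of these. *)
Lemma level_span_sub (A : {aspace aT}) y :
  y \in A -> (forall a, e a \in A) ->
  (forall a b, odd (l a) != odd (l b) ->
     exists2 k, k != 0 & e a * y * e b = k *: x a b) ->
  (S <= A)%VS.
Proof.
move=> Ay Ae yE.
have Ax1 a b : odd (l a) != odd (l b) -> x a b \in A.
  move=> oab; have [k k0 kE] := yE a b oab.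
  by rewrite -[x a b](scalerK k0) -kE memvZ // !memvM.
have Ax a b : l a != l b -> x a b \in A.
  move=> lab; have [oab|] := boolP (odd (l a) != odd (l b)); first exact: Ax1.
  rewrite negbK => /eqP oab.
  suff [c [mon oc oc']] : exists c,
      [/\ (l a < l c < l b)%N || (l b < l c < l a)%N,
          odd (l a) != odd (l c) & odd (l c) != odd (l b)].
    have := @arrow_mul a c b; rewrite mon => <-; try lia.
    by rewrite memvM ?Ax1.
  (* Read as a bound on a successor, [lt_ab] gives a vertex one level above the lower end; as [l a]
     and [l b] have equal parity, it stays strictly below the upper one. *)
  case: (ltngtP (l a) (l b)) lab => // lt_ab _;
    by have [c cE] := level_surj lt_ab; exists c; split; lia.
apply/subv_sumP => [] [a b] _; rewrite -memvE /z /=; case: eqP => // _.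
by case: eqP => [_|/eqP]; [rewrite mem0v|exact: Ax].
Qed.

(** On equal levels the component of the radical is zero. On consecutive levels the arrow survives
    modulo the squared radical, and otherwise it factors through an intermediate level. *)
Lemma num_arrows_span a b : num_arrows S (e a) (e b) = consecutive a b.
Proof.
rewrite /num_arrows peirce_jacobson.
have [lab|nlab] := eqVneq (l a) (l b).
  rewrite add0v subnn /consecutive lab -[_ || _]negbK negb_or.
  by rewrite neq_ltn ltnSn.
have [cab|ncab] := boolP (consecutive a b).
  rewrite dimv_disjoint_sum ?addnK ?dim_vline ?arrow_neq0 //.
  apply/eqP; rewrite -subv0; apply/subvP => w /memv_capP[/vlineP[k ->] Jx].
  rewrite memv0; have [->|k0] := eqVneq k 0; first by rewrite scale0r.
  case/negP: (arrow_jacobson_sqr cab).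
  by rewrite -[x a b](scalerK k0) memvZ.
suff /addv_idPr-> : (<[x a b]> <= jacobson S * jacobson S)%VS by rewrite subnn.
rewrite -memvE.
have [c mon] : exists c, (l a < l c < l b)%N || (l b < l c < l a)%N.
  case: (ltngtP (l a) (l b)) nlab => // lt_ab _.
    have [|c cE] := @level_between a b; last by exists c; rewrite cE.
    rewrite ltn_neqAle lt_ab andbT; apply: contra ncab => ab.
    by rewrite /consecutive eq_sym ab.
  have [|c cE] := @level_between b a; last by exists c; rewrite cE orbT.
  rewrite ltn_neqAle lt_ab andbT; apply: contra ncab => ba.
  by rewrite /consecutive [l a == _]eq_sym ba orbT.
have lac : l a != l c by lia.
have lcb : l c != l b by lia.
have := arrow_mul lac lcb; rewrite mon => <-.
by rewrite memv_mul // arrow_jacobson.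
Qed.

Lemma span_gabriel_quiver :
  is_gabriel_quiver S e (fun a b => nat_of_bool (consecutive a b)).
Proof.
split=> [a|a b ab||a b|a b]; first exact: vertex_primitive.
- by rewrite vertex_mul (negPf ab).
- exact: sum_vertex.
- exact: vertex_not_isomorphic.
- exact: num_arrows_span.
Qed.

(** * Values of paths *)

Lemma path_value_mono s a b p :
  sorted (if s then ltn else gtn) (map l (a :: b :: p)) ->
  path_value e x a (b :: p) = E s a (last b p) /\
  (if s then ltn else gtn) (l a) (l (last b p)).
Proof.
elim: p a b => [|c p IH] a b.
  move=> /= /andP[lab _]; rewrite /x E_vertex eqxx; split=> //.
  by congr (E _ a b); case: s lab => //= /ltnW; rewrite leqNgt => /negPf.
move=> srt; have /andP[lab srt'] : (if s then ltn else gtn) (l a) (l b) && 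
   sorted (if s then ltn else gtn) (map l (b :: c :: p)) by [].
have [IH1 IH2] := IH b c srt'.
(* The first step has the direction [s] of the rest of the path, so the product telescopes to one
   matrix unit. *)
have sE : (l a < l b)%N = s.
  by case: (s) lab => //= /ltnW; rewrite leqNgt => /negPf.
rewrite [path_value _ _ _ _]/= -/(path_value e x b (c :: p)) IH1 /x sE E_mul.
rewrite !eqxx; split=> //.
by case: (s) lab IH2 => /= h1 h2; [apply: ltn_trans h1 h2|apply: ltn_trans h2 h1].
Qed.

Definition monotone (s : seq I) :=
  sorted ltn (map l s) || sorted gtn (map l s).

Lemma path_value_monotone a b p : monotone (a :: b :: p) ->
  path_value e x a (b :: p) = x a (last b p) /\ l a != l (last b p).
Proof.
case/orP => [srt|srt].
  have [-> ltab] := @path_value_mono true a b p srt; rewrite /x.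
  by rewrite [(_ < _)%N]ltab neq_ltn [(_ < _)%N]ltab.
have [-> ltba] := @path_value_mono false a b p srt; rewrite /x.
by rewrite ltnNge ltnW //= neq_ltn orbC [(_ < _)%N]ltba.
Qed.

(** By induction only a monotone tail matters. It is a single matrix unit, and the first step has
    the other direction. *)
Lemma path_value_nonmonotone a p :
  path consecutive a p -> ~~ monotone (a :: p) -> path_value e x a p = 0.
Proof.
elim: p a => [|b p IH] a //= /andP[cab pth] nmon.
have [mon|nmon'] := boolP (monotone (b :: p)); last by rewrite IH ?mulr0.
have lab := consecutive_neq cab.
case: p pth mon nmon {IH} => [|c p] pth mon nmon.
  (* A single step between different levels is monotone, so the tail cannot be empty. *)
  by exfalso; move: nmon lab; rewrite /monotone /= !andbT; lia.
have vanish s : sorted (if s then ltn else gtn) (map l (b :: c :: p)) ->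
    ~~ sorted (if s then ltn else gtn) (map l (a :: b :: c :: p)) ->
    x a b * path_value e x b (c :: p) = 0.
  move=> srt; have [-> _] := path_value_mono srt.
  rewrite /x E_mul; case: eqP => // sE nsrt.
  case/negP: nsrt; apply/andP; split=> //; rewrite -sE.
  by move: lab; case: ltngtP.
case/norP: nmon => nlt ngt.
by case/orP: mon => srt; [apply: (vanish true)|apply: (vanish false)].
Qed.

Lemma path_value_eq a p q :
  monotone (a :: p) -> monotone (a :: q) -> last a p = last a q ->
  path_value e x a p = path_value e x a q.
Proof.
case: p q => [|b p] [|c q] // monp monq.
(* A nonempty monotone path ends on a level other than its initial one, so it never shares its
   endpoints with the trivial path. *)
- by move=> /= lq; have [_] := path_value_monotone monq; rewrite -lq eqxx.
- by move=> /= lp; have [_] := path_value_monotone monp; rewrite lp eqxx.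
rewrite [last a _]/= [last a (_ :: _)]/= => lpq.
have [-> _] := path_value_monotone monp.
by have [-> _] := path_value_monotone monq; rewrite lpq.
Qed.

End LevelAlgebra.

(** * Isomorphisms of subalgebras induced by conjugation *)

Section Conjugation.

Variables (K : fieldType) (aT : falgType K).

Lemma conj_algebra_isomorphic (A B : {aspace aT}) (q q' : aT) :
  1 \in A -> 1 \in B -> q * q' = 1 -> q' * q = 1 ->
  (forall y, y \in A -> q * y * q' \in B) ->
  (forall y, y \in B -> q' * y * q \in A) ->
  algebra_isomorphic A B.
Proof.
move=> A1 B1 qq' q'q AB BA.
(* The unit of [subvs_of A] is [algid A]; conjugation preserves units once this is the ambient 1. *)
have /eqP A1E : algid A == 1 by rewrite algid_eq1.
have /eqP B1E : algid B == 1 by rewrite algid_eq1.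
pose f := (linfun (vsproj B) \o amulr q' \o amull q \o linfun vsval)%VF
  : 'Hom(subvs_of A, subvs_of B).
pose g := (linfun (vsproj A) \o amulr q \o amull q' \o linfun vsval)%VF
  : 'Hom(subvs_of B, subvs_of A).
have fE y : vsval (f y) = q * vsval y * q'.
  by rewrite !comp_lfunE !lfunE /= vsprojK // AB ?subvsP.
have gE y : vsval (g y) = q' * vsval y * q.
  by rewrite !comp_lfunE !lfunE /= vsprojK // BA ?subvsP.
have f_ahom : ahom_in {:subvs_of A} f.
  apply/ahom_inP; split=> [y w _ _|]; apply: subvs_inj.
    rewrite fE [vsval (y * w)]/= [vsval (_ * _)]/= !fE !mulrA.
    by rewrite -(mulrA _ q' q) q'q mulr1.
  by rewrite fE [vsval 1]/= A1E mulr1 qq' /= B1E.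
exists (AHom f_ahom); exists g => y; apply: subvs_inj.
  by rewrite gE fE !mulrA q'q mul1r -mulrA q'q mulr1.
by rewrite fE gE !mulrA qq' mul1r -mulrA qq' mulr1.
Qed.

Lemma level_span_conj (I : finType) (l : I -> nat) (E E' : bool -> I -> I -> aT)
    (q q' y : aT) :
  (forall s a b, q * E s a b * q' = E' s a b) ->
  y \in level_span l E -> q * y * q' \in level_span l E'.
Proof.
move=> EE'.
suff: (level_span l E <= (amulr q' \o amull q)%VF @^-1: level_span l E')%VS.
  by move/subvP=> sub /sub; rewrite -memv_preim !lfunE /= !lfunE.
apply/subv_sumP => [] [a b] _; rewrite -memvE -memv_preim !lfunE /= !lfunE /=.
have -> : q * level_unit l E a b * q' = level_unit l E' a b.
  rewrite /level_unit; case: eqP => _.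
    by rewrite /vertex mulrDr mulrDl !EE'.
  by case: eqP => _; rewrite ?mulr0 ?mul0r // /arrow EE'.
exact: (subvP (sumv_sup (a, b) _ _)) (memv_line _).
Qed.

Lemma level_span_isomorphic (I : finType) (l : I -> nat)
    (E E' : bool -> I -> I -> aT) (A B : {aspace aT}) (q q' : aT) :
  A = level_span l E :> {vspace aT} -> B = level_span l E' :> {vspace aT} ->
  1 \in A -> 1 \in B -> q * q' = 1 -> q' * q = 1 ->
  (forall s a b, q * E s a b * q' = E' s a b) ->
  algebra_isomorphic A B.
Proof.
move=> AE BE A1 B1 qq' q'q EE'.
apply: (conj_algebra_isomorphic A1 B1 qq' q'q) => y; rewrite AE BE.
  exact: level_span_conj.
apply: level_span_conj => s a b.
by rewrite -EE' !mulrA q'q mul1r -mulrA q'q mulr1.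
Qed.

End Conjugation.

(** * Fourier analysis on Z/N *)

Section RootsOfUnity.

Variables (R : realType) (N : nat).
Hypothesis N_gt1 : (1 < N)%N.

Local Notation w := (omega R N).

Lemma omegaX k : w ^+ k =
  Complex (cos (k%:R * (2 * pi / N%:R))) (sin (k%:R * (2 * pi / N%:R))).
Proof.
elim: k => [|k IH]; first by rewrite expr0 mul0r cos0 sin0.
have -> : k.+1%:R * (2 * pi / N%:R) = k%:R * (2 * pi / N%:R) + 2 * pi / N%:R :> R.
  by rewrite -natr1 [LHS]mulrDl mul1r.
rewrite exprSr IH /omega cosD sinD.
by apply/eqP; rewrite eq_complex /= eqxx addrC eqxx.
Qed.

(** With [h = k * pi / N] strictly between 0 and [pi], the real part of the power is
    [1 - 2 * sin h ^+ 2], which is below 1. *)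
Lemma omega_neq1 k : (0 < k < N)%N -> w ^+ k != 1.
Proof.
move=> /andP[k0 kN]; rewrite omegaX eq_complex negb_and /=; apply/orP; left.
set h : R := k%:R * (pi / N%:R).
have -> : k%:R * (2 * pi / N%:R) = h *+ 2 :> R by rewrite /h -mulr_natl; ring.
have N0 : (0 : R) < N%:R by rewrite ltr0n (ltn_trans _ N_gt1).
have sin_gt0 : 0 < sin h.
  apply: sin_gt0_pi; rewrite /h mulr_gt0 ?ltr0n ?divr_gt0 ?pi_gt0 //=.
  by rewrite mulrCA gtr_pMr ?pi_gt0 // ltr_pdivrMr // mul1r ltr_nat.
rewrite cos_mulr2n cos2sin2 lt_eqF //.
have : 0 < sin h ^+ 2 by rewrite exprn_gt0.
lra.
Qed.

Lemma omegaN1 : w ^+ N = 1.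
Proof.
rewrite omegaX mulrCA divff ?mulr1 ?pnatr_eq0; last by case: (N) N_gt1.
by rewrite mulr_natl cos2pi sin2pi.
Qed.

End RootsOfUnity.

Section Fourier.

Variables (R : realType) (N : nat).
Hypothesis N_gt1 : (1 < N)%N.

Local Notation w := (omega R N).
Local Notation M := (Zp_trunc N).+2.

Definition chi (a j : 'Z_N) : R[i] := w ^+ (a * j)%N.

(** The eigenvectors of [tmx], followed by their dual basis. *)
Definition vcol (a : 'Z_N) : 'cV[R[i]]_M := \col_j chi a j.
Definition vrow (a : 'Z_N) : 'rV[R[i]]_M := \row_j (N%:R^-1 * chi (- a) j).

Lemma omega_neq0 : w != 0.
Proof.
apply/eqP => w0; have := omegaN1 R N_gt1; rewrite w0 expr0n.
by case: (N) N_gt1 => //= ? _ /eqP; rewrite eq_sym oner_eq0.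
Qed.

Lemma omegaM1 : w ^+ M = 1.
Proof. by rewrite Zp_cast // omegaN1. Qed.

Lemma omega_modM k : w ^+ (k %% M) = w ^+ k.
Proof. exact: expr_mod omegaM1. Qed.

Lemma chiC a j : chi a j = chi j a.
Proof. by rewrite /chi mulnC. Qed.

Lemma chiD a b j : chi (a + b) j = chi a j * chi b j.
Proof.
by rewrite /chi -exprD -mulnDl ![in LHS]exprM ![in RHS]exprM /= omega_modM.
Qed.

Lemma chi0 j : chi 0 j = 1.
Proof. by rewrite /chi mul0n. Qed.

Lemma chi_neq0 a j : chi a j != 0.
Proof. by rewrite expf_neq0 // omega_neq0. Qed.

Lemma chiN a j : chi (- a) j = (chi a j)^-1.
Proof.
apply: (mulIf (chi_neq0 a j)); rewrite -chiD addNr chi0 mulVf //.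
exact: chi_neq0.
Qed.

Lemma chi1 a : chi a 1 = w ^+ a.
Proof. by rewrite /chi /= modn_small ?muln1. Qed.

Lemma sum_chi a : \sum_j chi a j = if a == 0 then N%:R else 0.
Proof.
have [->|a0] := eqVneq a 0.
  under eq_bigr do rewrite chi0.
  by rewrite sumr_const card_ord Zp_cast.
have : w ^+ a != 1.
  apply: omega_neq1 => //; apply/andP; split; first by rewrite lt0n.
  by rewrite -[ltnRHS](Zp_cast N_gt1).
rewrite -subr_eq0 => wa1; apply: (mulfI wa1); rewrite mulr0.
have -> : \sum_j chi a j = \sum_(j < M) (w ^+ a) ^+ j.
  by apply: eq_bigr => j _; rewrite -exprM.
by rewrite -subrX1 -exprM mulnC exprM omegaM1 expr1n subrr.
Qed.

Lemma N_neq0 : N%:R != 0 :> R[i].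
Proof. by rewrite pnatr_eq0; case: (N) N_gt1. Qed.

Lemma vrow_col a b : vrow a *m vcol b = (a == b)%:R%:M.
Proof.
rewrite [LHS]mx11_scalar; congr _%:M; rewrite mxE.
under eq_bigr do rewrite !mxE -mulrA -chiD.
rewrite -mulr_sumr sum_chi addrC subr_eq0 eq_sym.
by case: eqP; rewrite ?mulr0 // mulVf ?N_neq0.
Qed.

Lemma sum_vcol_row : \sum_a vcol a *m vrow a = 1%:M.
Proof.
apply/matrixP => i j; rewrite summxE !mxE.
have chiB a : chi a i * chi (- a) j = chi (i - j) a.
  by rewrite chiN chiC [chi a j]chiC -chiN -chiD.
under eq_bigr => a _ do rewrite mxE big_ord1 !mxE mulrCA chiB.
rewrite -mulr_sumr sum_chi subr_eq0.
by case: eqP; rewrite ?mulr0 // mulVf ?N_neq0.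
Qed.

Lemma tmx_vcol a : tmx R N *m vcol a = w ^+ a *: vcol a.
Proof.
apply/colP => i; rewrite !mxE (bigD1 (i + 1)) //= big1 => [|j ji].
  by rewrite !mxE addrK eqxx mul1r addr0 chiC chiD mulrC -!(chiC a) chi1.
by rewrite !mxE -subr_eq opprK eq_sym (negPf ji) mul0r.
Qed.

Lemma tmx_unit : tmx R N \is a GRing.unit.
Proof.
suff /mulmx1_unit[] : tmx R N *m (tmx R N)^T = 1%:M by [].
apply/matrixP => i k; rewrite !mxE (bigD1 (i + 1)) //= big1 => [|j ji].
  by rewrite !mxE addrK eqxx mul1r addr0 eq_sym.
by rewrite !mxE -subr_eq opprK eq_sym (negPf ji) mul0r.
Qed.

Lemma tmxV_vcol a : (tmx R N)^-1 *m vcol a = w ^- a *: vcol a.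
Proof.
have wa : w ^+ a != 0 by rewrite expf_neq0 ?omega_neq0.
apply: (scalerI wa); rewrite scalerA divff // scale1r scalemxAr -tmx_vcol.
by rewrite mulmxA [_ *m tmx R N](mulVr tmx_unit) mul1mx.
Qed.

Lemma invr_diag (r : 'rV[R[i]]_M) : (forall j, r 0 j != 0) ->
  (diag_mx r)^-1 = diag_mx (\row_j (r 0 j)^-1).
Proof.
move=> r0; have rr' : diag_mx r * diag_mx (\row_j (r 0 j)^-1) = 1.
  rewrite [LHS]mulmx_diag -[1]diag_const_mx; congr diag_mx.
  by apply/rowP => j; rewrite !mxE mulfV.
have ru : diag_mx r \is a GRing.unit by have /mulmx1_unit[] := rr'.
by apply: (mulrI ru); rewrite rr' mulrV.
Qed.

Lemma twistN (u : R[i]) j : (u * w ^+ j) ^+ N = u ^+ N.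
Proof. by rewrite exprMn exprAC omegaN1 // expr1n mulr1. Qed.

(** As [N] is even, a square equal to 1 would give [u ^+ N = 1]. This makes the diagonal entries
    inverted in [smx] nonzero. *)
Lemma twist_sqr_neq1 (u : R[i]) j : u ^+ N != 1 -> ~~ odd N ->
  (u * w ^+ j) ^+ 2 - 1 != 0.
Proof.
move=> uN1 evN; rewrite subr_eq0; apply: contra uN1 => /eqP z2.
have sqr1 (z : R[i]) : z ^+ 2 = 1 -> z ^+ N = 1.
  by rewrite -(even_halfK evN) -mul2n exprM => ->; rewrite expr1n.
by rewrite -(twistN u j) sqr1.
Qed.

Lemma smx_diag (u : R[i]) : u != 0 -> u ^+ N != 1 -> ~~ odd N ->
  smx N u = diag_mx (\row_(j < M) (u * w ^+ j / ((u * w ^+ j) ^+ 2 - 1))).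
Proof.
move=> u0 uN1 evN.
have z2 (j : 'I_M) := twist_sqr_neq1 j uN1 evN.
have w0 (j : 'I_M) : w ^+ j != 0 by rewrite expf_neq0 ?omega_neq0.
have dE : dmx R N = diag_mx (\row_j w ^+ j).
  by apply/matrixP => i j; rewrite !mxE; case: eqP => [->|]; rewrite ?mulr1n.
have -> : smx N u = (diag_mx (\row_(j < M) (u * w ^+ j - (u * w ^+ j)^-1)))^-1.
  rewrite /smx dE invr_diag => [|j]; last by rewrite mxE.
  congr (_^-1); rewrite -!linearZ -linearB /=; congr diag_mx.
  by apply/rowP => j; rewrite !mxE invfM.
rewrite invr_diag => [|j].
  congr diag_mx; apply/rowP => j; rewrite !mxE; field.
  by rewrite w0 z2 u0.
rewrite mxE.
have -> : u * w ^+ j - (u * w ^+ j)^-1 = ((u * w ^+ j) ^+ 2 - 1) / (u * w ^+ j).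
  by field; rewrite w0 u0.
by rewrite mulf_neq0 // invr_eq0 mulf_neq0.
Qed.

(* Fourier coefficients of the diagonal of s: with z = u w^j of N-th power u^N,
   z / (z^2 - 1) is the sum of the odd powers z^m, m < N, over u^N - 1. *)
Definition shat (u : R[i]) (m : 'Z_N) : R[i] :=
  if odd m then u ^+ m / (u ^+ N - 1) else 0.

(** The odd powers form a geometric progression of ratio [z ^+ 2]; keeping the factor on the left
    avoids a division. *)
Lemma sum_odd_powers (z : R[i]) k :
  (z ^+ 2 - 1) * \sum_(m < k.*2) (if odd m then z ^+ m else 0) =
  z * (z ^+ k.*2 - 1).
Proof.
elim: k => [|k IH]; first by rewrite big_ord0 expr0 subrr !mulr0.
rewrite doubleS !big_ord_recr /= odd_double /= addr0 mulrDr IH.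
rewrite !exprS; ring.
Qed.

(** A diagonal matrix acts by pointwise multiplication, so expanding its diagonal into characters
    turns its action on [vcol b] into index shifts by [b]. *)
Lemma smx_vcol (u : R[i]) b : u != 0 -> u ^+ N != 1 -> ~~ odd N ->
  smx N u *m vcol b = \sum_a shat u (a - b) *: vcol a.
Proof.
move=> u0 uN1 evN; rewrite smx_diag //.
rewrite (reindex_inj (addIr b)) /=; apply/colP => j; rewrite summxE.
rewrite mul_diag_mx !mxE.
under eq_bigr do rewrite !mxE addrK chiD mulrA.
rewrite -mulr_suml; congr (_ * _).
set z := u * w ^+ j.
have z2 : z ^+ 2 - 1 != 0 by apply: twist_sqr_neq1.
have uN : u ^+ N - 1 != 0 by rewrite subr_eq0.
have sumE : (z ^+ 2 - 1) * \sum_(m < M) (if odd m then z ^+ m else 0) =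
    z * (u ^+ N - 1).
  have ME : M = N./2.*2 by rewrite Zp_cast // even_halfK.
  rewrite -(twistN u j) -/z -(Zp_cast N_gt1); move: z {z2} => z.
  by rewrite ME sum_odd_powers.
have -> : \sum_(m : 'Z_N) shat u m * chi m j =
    (\sum_(m < M) (if odd m then z ^+ m else 0)) / (u ^+ N - 1).
  rewrite mulr_suml; apply: eq_bigr => m _; rewrite /shat.
  case: ifP => _; last by rewrite !mul0r.
  by rewrite /z exprMn -exprM [(j * m)%N]mulnC /chi; ring.
by apply: (mulfI z2); rewrite [RHS]mulrA sumE; field; rewrite z2 uN.
Qed.

End Fourier.

(** * The basis adapted to Lambda *)

Section Exponents.

Variable N : nat.
Hypothesis N_gt1 : (1 < N)%N.
Hypothesis evN : ~~ odd N.

Local Notation M := (Zp_trunc N).+2.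

Lemma ltn_Zp (a : 'Z_N) : (a < N)%N.
Proof. by rewrite -[ltnRHS](Zp_cast N_gt1). Qed.

Lemma odd_level (a : 'Z_N) : odd (level a) = odd a.
Proof.
rewrite /level /minn; case: ifP => // _.
by rewrite oddB ?(ltnW (ltn_Zp a)) // (negPf evN).
Qed.

Lemma level_le_half (a : 'Z_N) : (level a <= N./2)%N.
Proof. by rewrite /level; lia. Qed.

Lemma level_onto (b : 'Z_N) k : (k <= level b)%N -> exists c : 'Z_N, level c = k.
Proof.
move=> kb; have := level_le_half b => lb; exists k%:R.
by rewrite /level val_Zp_nat // modn_small; lia.
Qed.

Lemma val_ZpD (a b : 'Z_N) :
  (a + b)%R = (if (a + b < N)%N then a + b else a + b - N)%N :> nat.
Proof.
have := ltn_Zp a; have := ltn_Zp b => bN aN.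
rewrite [LHS]/=; move: (nat_of_ord a) (nat_of_ord b) aN bN => i j iN jN.
rewrite Zp_cast //; case: ltnP => abN; first by rewrite modn_small.
by rewrite -[in LHS](subnK abN) modnDr modn_small //; lia.
Qed.

Lemma val_ZpN (a : 'Z_N) :
  (- a)%R = (if a == 0%N :> nat then 0%N else N - a)%N :> nat.
Proof.
have := ltn_Zp a; rewrite [LHS]/=; move: (nat_of_ord a) => i iN.
rewrite Zp_cast //.
by case: eqP => [->|a0]; rewrite ?subn0 ?modnn // modn_small //; lia.
Qed.

Lemma val_ZpB (a b : 'Z_N) :
  (a - b)%R = (if (b <= a)%N then a - b else N + a - b)%N :> nat.
Proof.
have := ltn_Zp a; have := ltn_Zp b; rewrite val_ZpD val_ZpN.
move: (nat_of_ord a) (nat_of_ord b) => i j jN iN.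
case: eqP => [->|/eqP]; first by rewrite addn0 iN leq0n subn0.
by rewrite -lt0n => j0; case: (leqP j i) => ji; case: ltnP => h; lia.
Qed.

(** Opposite parities exclude [a + b = 0] and [a + b = N], the sums at which the residue would be
    0. *)
Lemma val_ZpND (a b : 'Z_N) : odd a != odd b ->
  (- a - b)%R = (if (a + b < N)%N then N - (a + b) else 2 * N - (a + b))%N :> nat.
Proof.
move=> oab; rewrite -opprD val_ZpN val_ZpD.
have ab0 : (a + b != 0)%N.
  apply: contraNneq oab => /eqP.
  by rewrite addn_eq0 => /andP[/eqP-> /eqP->].
have abN : (a + b != N)%N.
  by apply: contraNneq evN => <-; rewrite oddD -negb_eqb.
move: (ltn_Zp a) (ltn_Zp b) ab0 abN; move: (nat_of_ord a) (nat_of_ord b) => i j.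
move=> iN jN ij0 ijN; case: ltnP => h; first by rewrite (negPf ij0).
by rewrite subn_eq0 leqNgt ltn_neqAle eq_sym ijN h /=; lia.
Qed.

Lemma odd_ZpD (a b : 'Z_N) : odd (a + b)%R = (odd a != odd b).
Proof.
rewrite val_ZpD negb_eqb; case: ltnP => h; first by rewrite oddD.
by rewrite oddB // oddD (negPf evN) addbF.
Qed.

Lemma odd_ZpN (a : 'Z_N) : odd (- a)%R = odd a.
Proof.
rewrite val_ZpN; case: eqP => [->//|_].
by rewrite oddB ?(negPf evN) // ltnW // ltn_Zp.
Qed.

Lemma ltn_level (a b : 'Z_N) : (level a < level b)%N =
  if (a <= N./2)%N then (if (b <= N./2)%N then a < b else a + b < N)%N
  else (if (b <= N./2)%N then N < a + b else b < a)%N.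
Proof.
have levelE (c : 'Z_N) : level c = if (c <= N./2)%N then c : nat else (N - c)%N.
  have := ltn_Zp c; rewrite /level; move: (nat_of_ord c) => i iN.
  by case: leqP; lia.
rewrite !levelE; move: (ltn_Zp a) (ltn_Zp b).
move: (nat_of_ord a) (nat_of_ord b) => i j iN jN.
by case: (leqP i N./2) => ?; case: (leqP j N./2) => ?; lia.
Qed.

(* The line of direction s in the image of e_b is spanned by
   (u^p v_b, - u^q v_{-b}).  A decreasing direction gives (p, q) = (b, N - b);
   an increasing one gives (b, - b) for b taken in (- N/2, N/2], shifted by N to
   keep the exponents in nat. *)
Definition pexp (s : bool) (b : 'Z_N) : nat :=
  if s && (b <= N./2)%N then (N + b)%N else b.

Definition qexp (s : bool) (b : 'Z_N) : nat :=
  if s && (N./2 < b)%N then (2 * N - b)%N else (N - b)%N.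

(** These are the two exponents in the determinant comparing the lines of both directions in the
    image of [e_b]; they are [N] and [2 * N] in some order. *)
Lemma frame_expD s (b : 'Z_N) :
  ((pexp s b + qexp (~~ s) b = N) /\ (pexp (~~ s) b + qexp s b = 2 * N) \/
  (pexp s b + qexp (~~ s) b = 2 * N) /\ (pexp (~~ s) b + qexp s b = N))%N.
Proof.
have bN := ltn_Zp b; rewrite /pexp /qexp.
by case: s => /=; case: (leqP b N./2) => lb; lia.
Qed.

Lemma parity_neq (a b : 'Z_N) : odd a != odd b ->
  (a : nat) != b /\ (a + b)%N != N.
Proof.
move=> oab; split; first by apply: contraNneq oab => ->.
by apply: contraNneq evN => <-; rewrite oddD -negb_eqb.
Qed.

(** For the wrong direction the two terms of each Fourier coefficient of the image carry the same
    power of [u] and cancel. *)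
Lemma frame_exp_cancel s (a b : 'Z_N) :
  odd a != odd b -> s != (level a < level b)%N ->
  (pexp s b + (a - b)%R = qexp s b + (a + b)%R /\
   pexp s b + (- a - b)%R = qexp s b + (b - a)%R)%N.
Proof.
move=> oab sE; have -> : s = ~~ (level a < level b)%N.
  by case: (s) (level a < level b)%N sE => [] [].
move: (ltn_Zp a) (ltn_Zp b) (parity_neq oab).
rewrite ltn_level val_ZpND // !val_ZpB val_ZpD /pexp /qexp.
have : N = (N./2 + N./2)%N by rewrite addnn even_halfK.
move: (nat_of_ord a) (nat_of_ord b) N./2 => i j n; clear.
move: (N) => M -> iN jN [ij ijN].
case: (leqP i n) => hi; case: (leqP j n) => hj; case: (ltngtP i j) ij => // hij _;
  case: (ltngtP (i + j) (n + n)) ijN => // hijN _; rewrite /=; lia.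
Qed.

(** For the right direction the two powers differ by a factor [u ^+ N], so their difference cancels
    the denominator of [shat] and leaves, up to sign, the coordinates of the line at [a]. *)
Lemma frame_exp_lift (a b : 'Z_N) : odd a != odd b ->
  let s := (level a < level b)%N in
  if s == (b <= N./2)%N then
    [/\ pexp s b + (a - b)%R = N + pexp s a,
        qexp s b + (a + b)%R = pexp s a,
        pexp s b + (- a - b)%R = N + qexp s a &
        qexp s b + (b - a)%R = qexp s a]%N
  else
    [/\ pexp s b + (a - b)%R = pexp s a,
        qexp s b + (a + b)%R = N + pexp s a,
        pexp s b + (- a - b)%R = qexp s a &
        qexp s b + (b - a)%R = N + qexp s a]%N.
Proof.
move=> oab s; move: (ltn_Zp a) (ltn_Zp b) (parity_neq oab).
rewrite /s ltn_level val_ZpND // !val_ZpB val_ZpD /pexp /qexp.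
have : N = (N./2 + N./2)%N by rewrite addnn even_halfK.
move: (nat_of_ord a) (nat_of_ord b) N./2 => i j n; clear.
move: (N) => M -> iN jN [ij ijN].
case: (leqP i n) => hi; case: (leqP j n) => hj; case: (ltngtP i j) ij => // hij _;
  case: (ltngtP (i + j) (n + n)) ijN => // hijN _;
  rewrite /=; try lia; split; lia.
Qed.

End Exponents.

(** This is the product of a 2 by 2 matrix of determinant [d] with its inverse, carried by the
    vectors [v], [v'] and covectors [w], [w']. *)
Lemma frame_completeness (F : fieldType) m (v v' : 'cV[F]_m) (w w' : 'rV[F]_m)
    (x y x' y' d : F) : d = x * y' - x' * y -> d != 0 ->
  col_mx (x *: v) (y *: v') *m (d^-1 *: row_mx (y' *: w) (- x' *: w')) +
  col_mx (x' *: v) (y' *: v') *m ((- d)^-1 *: row_mx (y *: w) (- x *: w')) =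
  block_mx (v *m w) 0 0 (v' *m w').
Proof.
move=> dE d0; rewrite -!scalemxAr !mul_col_row -!scalemxAl -!scalemxAr !scalerA.
rewrite !scale_block_mx add_block_mx !scalerA -!scalerDl.
have -> : d^-1 * (x * y') + (- d)^-1 * (x' * y) = 1.
  by rewrite invrN mulNr -mulrBr -dE mulVf.
have -> : d^-1 * (y * - x') + (- d)^-1 * (y' * - x) = 1.
  have xyd : y * - x' - y' * - x = d by rewrite dE; ring.
  by rewrite invrN mulNr -mulrBr xyd mulVf.
have -> : d^-1 * (x * - x') + (- d)^-1 * (x' * - x) = 0 by rewrite invrN; ring.
have -> : d^-1 * (y * y') + (- d)^-1 * (y' * y) = 0 by rewrite invrN; ring.
by rewrite !scale1r !scale0r.
Qed.

(** * The frame of [u], and the blocks of [Tmx] and [Lambdamx] in it *)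

Section Frame.

Variables (R : realType) (N : nat).
Hypothesis N_gt1 : (1 < N)%N.
Hypothesis evN : ~~ odd N.

Local Notation M := (Zp_trunc N).+2.

(** The block identities are retyped at the size of [op2N], which is convertible to a sum but not
    displayed as one. *)
Lemma add_block_op (A B C D A' B' C' D' : opN R N) :
  (block_mx A B C D : op2N R N) + block_mx A' B' C' D' =
  block_mx (A + A') (B + B') (C + C') (D + D').
Proof. exact: (@add_block_mx _ M M M M). Qed.

Lemma mul_block_op (A B C D A' B' C' D' : opN R N) :
  (block_mx A B C D : op2N R N) * block_mx A' B' C' D' =
  block_mx (A *m A' + B *m C') (A *m B' + B *m D')
           (C *m A' + D *m C') (C *m B' + D *m D').
Proof. exact: (@mulmx_block _ M M M M M M). Qed.

Lemma scale_block_op k (A B C D : opN R N) :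
  k *: (block_mx A B C D : op2N R N) =
  block_mx (k *: A) (k *: B) (k *: C) (k *: D).
Proof. exact: (@scale_block_mx _ M M M M). Qed.

Lemma sum_block_op (I : finType) (f g : I -> opN R N) :
  \sum_a (block_mx (f a) 0 0 (g a) : op2N R N) =
  block_mx (\sum_a f a) 0 0 (\sum_a g a).
Proof.
apply: (big_rec3 (fun (z : op2N R N) (x y : opN R N) => z = block_mx x 0 0 y)).
  by rewrite block_mx0.
by move=> a z x y _ ->; rewrite add_block_op !addr0.
Qed.

Lemma sum_ord_Zp (F : nat -> R[i]) :
  \sum_(k < N) F k = \sum_(k : 'Z_N) F k.
Proof. by rewrite -!(big_mkord predT) Zp_cast. Qed.

Variable u : R[i].
Hypothesis u_neq0 : u != 0.
Hypothesis uN_neq1 : u ^+ N != 1.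

Definition frame_col (s : bool) (a : 'Z_N) : 'cV[R[i]]_(M + M) :=
  col_mx (u ^+ pexp s a *: vcol R a) (- u ^+ qexp s a *: vcol R (- a)).

(** The determinant of [frame_col s a] and [frame_col (~~ s) a] in the coordinates [(v_a, 0)],
    [(0, v_{-a})]. *)
Definition frame_det (s : bool) (a : 'Z_N) : R[i] :=
  u ^+ (pexp (~~ s) a + qexp s a) - u ^+ (pexp s a + qexp (~~ s) a).

(* The basis dual to frame_col. *)
Definition frame_row (s : bool) (a : 'Z_N) : 'rV[R[i]]_(M + M) :=
  (frame_det s a)^-1 *:
    row_mx (- u ^+ qexp (~~ s) a *: vrow R a)
           (- u ^+ pexp (~~ s) a *: vrow R (- a)).

(** Up to sign the determinant is [u ^+ N * (u ^+ N - 1)], so admissibility makes the two lines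
    independent. *)
Lemma frame_det_neq0 s a : frame_det s a != 0.
Proof.
have d0 : u ^+ N * (u ^+ N - 1) != 0 by rewrite mulf_neq0 ?expf_neq0 // subr_eq0.
rewrite /frame_det; case: (frame_expD N_gt1 evN s a) => [[-> ->]|[-> ->]].
  by rewrite mulnC exprM expr2 -[X in _ - X]mulr1 -mulrBr.
by rewrite mulnC exprM expr2 -opprB oppr_eq0 -[X in _ - X]mulr1 -mulrBr.
Qed.

Lemma frame_detN s a : frame_det (~~ s) a = - frame_det s a.
Proof. by rewrite /frame_det negbK opprB. Qed.

Lemma frame_dual s r a b :
  frame_row s a *m frame_col r b = ((s == r) && (a == b))%:R%:M.
Proof.
rewrite /frame_row /frame_col -scalemxAl mul_row_col -!scalemxAl -!scalemxAr.
rewrite !vrow_col // eqr_opp !scale_scalar_mx -raddfD /= scale_scalar_mx.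
congr _%:M; have [<-|_] := eqVneq a b; last by rewrite andbF !mulr0 addr0 mulr0.
rewrite andbT !mulr1; have [<-|sr] := eqVneq s r.
  apply: (mulfI (frame_det_neq0 s a)); rewrite mulrA divff ?frame_det_neq0 //.
  by rewrite mulr1 /frame_det !exprD; ring.
have -> : r = ~~ s by case: (s) (r) sr => [] [].
by rewrite mulr0n; ring.
Qed.

Definition frame_unit s a b : op2N R N := frame_col s a *m frame_row s b.

Lemma frame_unit_col s a b r c :
  frame_unit s a b *m frame_col r c =
  if (s == r) && (b == c) then frame_col s a else 0.
Proof.
rewrite -mulmxA frame_dual mul_mx_scalar.
by case: ifP; rewrite ?scale1r ?scale0r.
Qed.

(** The two lines together fill the whole image of [e_a], so the powers of [u] disappear from the
    sum. *)
Lemma frame_vertex a : vertex frame_unit a =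
  block_mx (vcol R a *m vrow R a) 0 0 (vcol R (- a) *m vrow R (- a)).
Proof.
rewrite /vertex /frame_unit /frame_row (frame_detN true) /=.
apply: (@frame_completeness _ _ (vcol R a) (vcol R (- a)) (vrow R a) (vrow R (- a))
  (u ^+ pexp true a) (- u ^+ qexp true a) (u ^+ pexp false a) (- u ^+ qexp false a)
  (frame_det true a) _ (frame_det_neq0 true a)).
by rewrite /frame_det !exprD /=; ring.
Qed.

Lemma frame_matrix_units : matrix_units frame_unit.
Proof.
split=> [s r a b c d|s a b|].
- rewrite [LHS]mulmxA frame_unit_col.
  by case: ifP => [/andP[/eqP-> _]|_]; rewrite ?mul0mx.
- apply/eqP => u0; have := frame_unit_col s a b s b.
  rewrite u0 mul0mx !eqxx /= => F0.
  have := frame_dual s s a a; rewrite -F0 mulmx0 !eqxx => /matrixP/(_ 0 0).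
  by rewrite !mxE eqxx => /eqP; rewrite eq_sym oner_eq0.
under eq_bigr => a _ do rewrite -/(vertex frame_unit a) frame_vertex.
rewrite sum_block_op.
have <- : \sum_(a : 'Z_N) vcol R a *m vrow R a =
    \sum_(a : 'Z_N) vcol R (- a) *m vrow R (- a).
  by rewrite [LHS](reindex_inj oppr_inj).
by rewrite sum_vcol_row // -scalar_mx_block.
Qed.

Lemma frame_sum1 : \sum_a vertex frame_unit a = 1.
Proof. by case: frame_matrix_units. Qed.

Lemma vertex_Tmx a :
  Tmx R N * vertex frame_unit a = omega R N ^+ a *: vertex frame_unit a.
Proof.
rewrite frame_vertex mul_block_op !mul0mx !mulmx0 !addr0 !add0r !mulmxA.
rewrite tmx_vcol // tmxV_vcol // -!scalemxAl scale_block_op !scaler0.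
by have -> : omega R N ^- (- a)%R = omega R N ^+ a
  by rewrite -!chi1 chiN // invrK.
Qed.

(** [Tmx] acts on the image of [vertex frame_unit b] by the scalar [omega R N ^+ b], and averaging
    against a character selects [b = a]. *)
Lemma idem_vertex a : idem R a = vertex frame_unit a.
Proof.
have TX k b : Tmx R N ^+ k * vertex frame_unit b =
    omega R N ^+ (b * k) *: vertex frame_unit b.
  elim: k => [|k IH]; first by rewrite mul1r muln0 scale1r.
  by rewrite exprSr -mulrA vertex_Tmx -scalerAr IH scalerA -exprD mulnS.
rewrite -[LHS]mulr1 -frame_sum1 mulr_sumr.
have idem_mul b : idem R a * vertex frame_unit b =
    if a == b then vertex frame_unit b else 0.
  rewrite /idem -scalerAl mulr_suml.
  under eq_bigr => k _ do rewrite -scalerAl TX scalerA.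
  rewrite -scaler_suml scalerA.
  have -> : \sum_(k < N) omega R N ^- (a * k) * omega R N ^+ (b * k) =
      \sum_k chi R (b - a) k.
    rewrite (sum_ord_Zp (fun k => omega R N ^- (a * k) * omega R N ^+ (b * k))).
    apply: eq_bigr => k _.
    by rewrite chiD // chiN // mulrC.
  rewrite sum_chi // subr_eq0 eq_sym; case: eqP => _.
    by rewrite mulVf ?N_neq0 // scale1r.
  by rewrite mulr0 scale0r.
rewrite (eq_bigr _ (fun b _ => idem_mul b)) -big_mkcond.
by under eq_bigl do rewrite eq_sym; rewrite big_pred1_eq.
Qed.

(** The sign records which of the two terms in [frame_exp_lift] carries the extra [N]. *)
Definition arrow_sign (a b : 'Z_N) : R[i] :=
  if (level a < level b)%N == (b <= N./2)%N then 1 else -1.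

(** The left side is the coefficient of [vcol R a] when [smx] is applied to the sum of the two
    halves of [frame_col s b]. *)
Lemma shat_frame s a b :
  u ^+ pexp s b * shat u (a - b) - u ^+ qexp s b * shat u (a + b) =
  if (odd a != odd b) && (s == (level a < level b)%N)
  then arrow_sign a b * u ^+ pexp s a else 0.
Proof.
have uN : u ^+ N - 1 != 0 by rewrite subr_eq0.
rewrite /shat !odd_ZpD // odd_ZpN //.
have [oab|] := boolP (odd a != odd b); last first.
  by rewrite !mulr0 subr0.
rewrite !mulrA -mulrBl -!exprD /=.
have [->|sab] := eqVneq s (level a < level b)%N; last first.
  have [-> _] := frame_exp_cancel N_gt1 evN oab sab.
  by rewrite subrr mul0r.
have := frame_exp_lift N_gt1 evN oab; rewrite /arrow_sign /=.
case: ifP => _ [-> -> _ _]; apply: (mulIf uN); rewrite mulfVK // exprD; ring.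
Qed.

(** The companion coefficient at [- a] carries the same sign, so both halves of the image fit one
    multiple of [frame_col s a]. *)
Lemma shat_frameN s a b :
  u ^+ pexp s b * shat u (- a - b) - u ^+ qexp s b * shat u (b - a) =
  if (odd a != odd b) && (s == (level a < level b)%N)
  then arrow_sign a b * u ^+ qexp s a else 0.
Proof.
have uN : u ^+ N - 1 != 0 by rewrite subr_eq0.
rewrite /shat !odd_ZpD // !odd_ZpN // [odd b == _]eq_sym.
have [oab|] := boolP (odd a != odd b); last first.
  by rewrite !mulr0 subr0.
rewrite !mulrA -mulrBl -!exprD /=.
have [->|sab] := eqVneq s (level a < level b)%N; last first.
  have [_ ->] := frame_exp_cancel N_gt1 evN oab sab.
  by rewrite subrr mul0r.
have := frame_exp_lift N_gt1 evN oab; rewrite /arrow_sign /=.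
case: ifP => _ [_ _ -> ->]; apply: (mulIf uN); rewrite mulfVK // exprD; ring.
Qed.

Lemma mul_block_col_op (A B C D : opN R N) (X Y : 'cV[R[i]]_M) :
  (block_mx A B C D : op2N R N) *m (col_mx X Y : 'cV_(M + M)) =
  col_mx (A *m X + B *m Y) (C *m X + D *m Y).
Proof. exact: (@mul_block_col _ M M M M 1). Qed.

Lemma Lambda_frame s b : Lambdamx N u *m frame_col s b =
  \sum_(a : 'Z_N) (if (odd a != odd b) && (s == (level a < level b)%N)
          then arrow_sign a b else 0) *: frame_col s a.
Proof.
pose k (a : 'Z_N) := if (odd a != odd b) && (s == (level a < level b)%N)
                     then arrow_sign a b else 0.
rewrite -[RHS]/(\sum_(a : 'Z_N) k a *: frame_col s a).
pose c a := u ^+ pexp s b * shat u (a - b) - u ^+ qexp s b * shat u (a + b).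
have SE : smx N u *m (u ^+ pexp s b *: vcol R b) +
    smx N u *m (- u ^+ qexp s b *: vcol R (- b)) =
    \sum_(a : 'Z_N) c a *: vcol R a.
  rewrite -!scalemxAr !smx_vcol // !scaler_sumr -big_split.
  by apply: eq_bigr => a _; rewrite /= !scalerA opprK -scalerDl mulNr.
have -> : \sum_(a : 'Z_N) k a *: frame_col s a = col_mx
    (\sum_(a : 'Z_N) (k a * u ^+ pexp s a) *: vcol R a)
    (\sum_(a : 'Z_N) (- (k a * u ^+ qexp s a)) *: vcol R (- a)).
  apply: (big_rec3 (fun z x y => z = col_mx x y)); first by rewrite col_mx0.
  by move=> a z x y _ ->; rewrite scale_col_mx add_col_mx !scalerA mulrN.
rewrite /Lambdamx /frame_col mul_block_col_op !mulNmx -opprD SE.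
(* The lower half of the image is minus the upper one; replacing [a] by [- a] expresses it through
   the lower halves of the frame. *)
have low : - (\sum_(a : 'Z_N) c a *: vcol R a) =
    \sum_(a : 'Z_N) (- (k a * u ^+ qexp s a)) *: vcol R (- a).
  rewrite [in LHS](reindex_inj oppr_inj) -sumrN; apply: eq_bigr => a _.
  rewrite -scaleNr /c [- a + b]addrC shat_frameN /k.
  by case: ifP => _ //; rewrite !mul0r.
rewrite low (eq_bigr (fun a => (k a * u ^+ pexp s a) *: vcol R a)) // => a _.
rewrite /c shat_frame /k.
by case: ifP => _ //; rewrite !mul0r.
Qed.

Lemma Lambda_comp a b :
  vertex frame_unit a * Lambdamx N u * vertex frame_unit b =
  (if odd a != odd b then arrow_sign a b else 0) *:
    arrow (@level N) frame_unit a b.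
Proof.
pose k s (a : 'Z_N) := if (odd a != odd b) && (s == (level a < level b)%N)
                       then arrow_sign a b else 0.
have LE s : Lambdamx N u * frame_unit s b b =
    \sum_(a : 'Z_N) k s a *: frame_unit s a b.
  rewrite [LHS]mulmxA Lambda_frame mulmx_suml.
  by apply: eq_bigr => c _; rewrite -scalemxAl.
have VE s : vertex frame_unit a * (Lambdamx N u * frame_unit s b b) =
    k s a *: frame_unit s a b.
  rewrite LE mulr_sumr.
  rewrite (eq_bigr (fun c => if a == c then k s c *: frame_unit s c b else 0)).
    rewrite -big_mkcond; under eq_bigl do rewrite eq_sym.
    by rewrite big_pred1_eq.
  move=> c _; rewrite -scalerAr (vertex_E frame_matrix_units).
  by case: eqP => [->|_]; rewrite ?scaler0.
have kE s : k s a = if s == (level a < level b)%N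
    then (if odd a != odd b then arrow_sign a b else 0) else 0.
  by rewrite /k andbC; case: (s == _).
rewrite -mulrA [in X in _ * X]mulrDr mulrDr.
apply: etrans (congr2 +%R (VE true) (VE false)) _.
rewrite (kE true) (kE false) /arrow; case: (level a < level b)%N.
  by rewrite [true == true]/= [false == true]/= scale0r addr0.
by rewrite [true == false]/= [false == false]/= scale0r add0r.
Qed.

Lemma arrow_sign_neq0 a b : arrow_sign a b != 0.
Proof. by rewrite /arrow_sign; case: ifP; rewrite ?oppr_eq0 oner_eq0. Qed.

(** Both generators have all their components in the span, which is closed under products.
    Conversely the [e_a] are polynomials in [Tmx], and the blocks of [Lambdamx] give the arrows
    between levels of opposite parity. *)
Lemma algA_level_span :
  algA N u = level_span (@level N) frame_unit :> {vspace _}.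
Proof.
have mu := frame_matrix_units.
apply/eqP; rewrite eqEsubv; apply/andP; split.
  have genS :
      (<<[:: Tmx R N; Lambdamx N u]>> <= level_span (@level N) frame_unit)%VS.
    apply/span_subvP => y; rewrite !inE => /orP[] /eqP->.
      apply/(mem_level_spanP _ mu) => a b.
      rewrite -mulrA vertex_Tmx -scalerAr (vertex_mul mu) memvZ //.
      by case: eqP => [->|_]; rewrite ?mem0v // /level_unit eqxx memv_line.
    apply/(mem_level_spanP _ mu) => a b; rewrite Lambda_comp.
    case: ifP => [oab|_]; last by rewrite scale0r mem0v.
    rewrite memvZ // unit_arrow ?memv_line //.
    by apply: contraTneq oab => lab; rewrite -!(odd_level N_gt1 evN) lab eqxx.
  apply: agenv_sub_modl; first by rewrite -memvE (span1 _ mu).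
  apply/prodvP => y z Uy Sz; apply: (span_mul mu) => //.
  exact: (subvP genS).
have Agen y : y \in [:: Tmx R N; Lambdamx N u] -> y \in algA N u.
  by move=> yU; apply: (subvP (sub_agenv _)); apply: memv_span.
have A1 : 1 \in algA N u by rewrite memvE sub1_agenv.
apply: (level_span_sub mu) (Lambdamx N u) _ _ _ => [b k|||a b].
- exact: level_onto.
- by rewrite Agen // !inE eqxx orbT.
- move=> a; rewrite -idem_vertex memvZ // rpred_sum // => k _; rewrite memvZ //.
  elim: (nat_of_ord k) => [|m IH]; first by rewrite expr0.
  by rewrite exprS memvM // Agen // mem_head.
rewrite !(odd_level N_gt1 evN) => oab; exists (arrow_sign a b).
  exact: arrow_sign_neq0.
by rewrite Lambda_comp oab.
Qed.

End Frame.

(** * Transition between the frames of two admissible parameters *)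

Section FrameChange.

Variables (R : realType) (N : nat).
Hypothesis N_gt1 : (1 < N)%N.
Hypothesis evN : ~~ odd N.

Local Notation M := (Zp_trunc N).+2.

Definition frame_change (u v : R[i]) : 'M[R[i]]_(M + M) :=
  \sum_(a : 'Z_N) (frame_col v true a *m frame_row u true a +
          frame_col v false a *m frame_row u false a).

Variables u v : R[i].
Hypotheses (u_neq0 : u != 0) (uN_neq1 : u ^+ N != 1).
Hypotheses (v_neq0 : v != 0) (vN_neq1 : v ^+ N != 1).

Lemma frame_change_col s b :
  frame_change u v *m frame_col u s b = frame_col v s b.
Proof.
rewrite mulmx_suml (eq_bigr (fun a => if a == b then frame_col v s a else 0)).
  by rewrite -big_mkcond big_pred1_eq.
move=> a _; rewrite mulmxDl -!mulmxA !(frame_dual N_gt1) // !mul_mx_scalar.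
by case: s; case: (a =P b) => [->|_]; rewrite /= ?scale1r ?scale0r ?addr0 ?add0r.
Qed.

Lemma frame_row_change s b :
  frame_row u s b *m frame_change v u = frame_row v s b.
Proof.
rewrite mulmx_sumr (eq_bigr (fun a => if b == a then frame_row v s a else 0)).
  by rewrite -big_mkcond (eq_bigl (pred1 b)) ?big_pred1_eq // => a;
    rewrite /= eq_sym.
move=> a _; rewrite mulmxDr !mulmxA !(frame_dual N_gt1) // !mul_scalar_mx.
by case: s; case: (b =P a) => _; rewrite /= ?scale1r ?scale0r ?addr0 ?add0r.
Qed.

Lemma frame_change_unit s a b :
  frame_change u v *m frame_unit u s a b *m frame_change v u = frame_unit v s a b.
Proof. by rewrite mulmxA frame_change_col -mulmxA frame_row_change. Qed.

End FrameChange.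

(** The second factor turns the dual rows for [u] into those for [v], leaving the resolution of the
    identity in the frame of [v]. *)
Lemma frame_changeK (R : realType) (N : nat) (u v : R[i]) :
  (1 < N)%N -> ~~ odd N -> u != 0 -> u ^+ N != 1 -> v != 0 -> v ^+ N != 1 ->
  frame_change N u v * frame_change N v u = 1.
Proof.
move=> N_gt1 evN u0 uN v0 vN; rewrite -(frame_sum1 N_gt1 evN v0 vN).
rewrite [LHS]mulmx_suml; apply: eq_bigr => a _.
by rewrite mulmxDl -!mulmxA !frame_row_change.
Qed.

(** * Peirce components, path relations, independence of [u] and Gabriel quiver of [algA] *)

Theorem theorem6p1 (R : realType) (n N : nat) (u : R[i])
    (hn : (2 <= n)%N) (hN : N = (2 * n)%N) (hu : admissible N u) :
  let A := algA N u in
  let e := @idem R N in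
  (forall a : 'Z_N, primitive_idempotent A (e a)) /\
  (exists x : 'Z_N -> 'Z_N -> op2N R N,
    [/\ (forall a b, level a != level b ->
           x a b != 0 /\ x a b \in peirce (e a) A (e b)),
        (forall a b, peirce (e a) A (e b) =
           if a == b then <[e a]>%VS
           else if level a == level b then 0%VS
           else <[x a b]>%VS),
        (forall a b c, level a != level b -> level b != level c ->
           x a b * x b c =
             if (level a < level b < level c)%N
                || (level c < level b < level a)%N
             then x a c else 0),
        (forall a b b' c, level a != level b -> level b' != level c ->
           b != b' -> x a b * x b' c = 0) &
        [/\ (forall a b, consecutive_levels a b ->
               represents_arrow A (e a) (e b) (x a b)),
            (forall a p, path (@consecutive_levels N) a p ->
               ~~ monotone_vertices (a :: p) -> path_value e x a p = 0) &
            (forall a p q,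
               path (@consecutive_levels N) a p ->
               path (@consecutive_levels N) a q ->
               monotone_vertices (a :: p) -> monotone_vertices (a :: q) ->
               last a p = last a q ->
               path_value e x a p = path_value e x a q)]]) /\
  (forall v : R[i], admissible N v -> algebra_isomorphic A (algA N v)) /\
  is_gabriel_quiver A e (fun a b => nat_of_bool (consecutive_levels a b)).
Proof.
move=> A e.
have N_gt1 : (1 < N)%N by lia.
have evN : ~~ odd N by rewrite hN mul2n odd_double.
have [u0 uN] := hu.
have mu := frame_matrix_units N_gt1 evN u0 uN.
have eE a : e a = vertex (frame_unit u) a := idem_vertex N_gt1 evN u0 uN a.
have AE : A = level_span (@level N) (frame_unit u) :> {vspace _} :=
  algA_level_span N_gt1 evN u0 uN.
split; first by move=> a; rewrite eE AE; apply: vertex_primitive mu a.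
split.
  exists (arrow (@level N) (frame_unit u)).
  split=> [a b lab|a b|a b c|a b b' c _ _|].
  - rewrite (arrow_neq0 _ mu); split=> //.
    by rewrite !eE AE (peirce_span _ mu) unit_arrow // memv_line.
  - rewrite !eE AE (peirce_span _ mu) /level_unit.
    by case: eqP => // _; case: eqP.
  - exact: arrow_mul.
  - exact: arrow_mul0.
  have pathE a p : path_value e (arrow (@level N) (frame_unit u)) a p =
      path_value (vertex (frame_unit u)) (arrow (@level N) (frame_unit u)) a p.
    by elim: p a => [|b p IH] a /=; rewrite ?eE ?IH.
  split=> [a b cab|a p pth nmon|a p q _ _ monp monq lpq].
  - by rewrite !eE AE; apply: consecutive_represents_arrow mu _ _ cab.
  - by rewrite pathE; apply: path_value_nonmonotone mu _ _ pth nmon.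
  - by rewrite !pathE; apply: path_value_eq mu _ _ _ monp monq lpq.
split=> [v [v0 vN]|].
  have BE := algA_level_span N_gt1 evN v0 vN.
  apply: (level_span_isomorphic AE BE (q := frame_change N u v)
    (q' := frame_change N v u)).
  - by rewrite memvE sub1_agenv.
  - by rewrite memvE sub1_agenv.
  - exact: frame_changeK.
  - exact: frame_changeK.
  - by move=> s a b; apply: frame_change_unit.
have [h1 h2 h3 h4 h5] := span_gabriel_quiver mu (level_onto N_gt1 evN).
split=> [a|a b ab||a b ab|a b]; rewrite ?eE ?AE.
- exact: h1.
- exact: h2.
- by rewrite -h3; apply: eq_bigr => a _; rewrite eE.
- exact: h4.
- exact: h5.
Qed.
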